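(* Let $u_{hk}$, $k=1,\ldots,n+m$, be a solution of the DG formulation on a simple network (one junction with incoming roads $1,\ldots,n$ and outgoing roads $n+1,\ldots,n+m$), with outflow data $u_{Dj}=u_{hj}^-(b_j)$ for $j=n+1,\ldots,n+m$. Then the DG scheme conserves the total number of vehicles in the network in the sense that $$\frac{\mathrm{d}}{\mathrm{d}t}\sum_{k=1}^{n+m}\int_{a_k}^{b_k}u_{hk}\,\mathrm{d}x=\sum_{i=1}^n H\big(u_{Di},u_{hi}^+(a_i)\big)-\sum_{j=n+1}^{n+m}H\big(u_{hj}^-(b_j),u_{Dj}\big),$$ both when the junction fluxes $H_i,H_j$ in the scheme are the $\alpha$-outside Godunov fluxes and when they are the $\alpha$-inside Godunov fluxes.
   Context: Junction: $n,m\ge 1$; each road $k\in\{1,\ldots,n+m\}$ is a bounded interval $[a_k,b_k]$; roads $1,\ldots,n$ are incoming (the junction is at their right endpoint $b_i$) and roads $n+1,\ldots,n+m$ are outgoing (the junction is at their left endpoint $a_j$). The traffic distribution coefficients $\alpha_{j,i}$ ($i=1,\ldots,n$, $j=n+1,\ldots,n+m$) satisfy $0\le\alpha_{j,i}\le1$ and $\sum_{j=n+1}^{n+m}\alpha_{j,i}=1$ for every $i$. Spaces: $\mathcal{T}_{hk}$ is a finite partition of $[a_k,b_k]$ into closed intervals with disjoint interiors, $\mathcal{F}_{hk}^I$ is the set of element endpoints lying in the open interval $(a_k,b_k)$, and $S_{hk}$ is the space of functions on $[a_k,b_k]$ that are polynomials of degree at most $p$ on each $K\in\mathcal{T}_{hk}$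 (possibly discontinuous between elements). One-sided traces are $v^-(x)=\lim_{y\to x-}v(y)$, $v^+(x)=\lim_{y\to x+}v(y)$, and the jump at interior points is $[v]_x=v^-(x)-v^+(x)$. Flux: $f\in C^1(\mathbb{R})$ has a global maximum at $u_*$, is non-decreasing on $(-\infty,u_*]$ and non-increasing on $[u_*,\infty)$. Set $f_{in}(u^-)=f(u^-)$ if $u^-<u_*$ and $f_{in}(u^-)=f(u_* )$ if $u^-\ge u_*$; $f_{out}(u^+)=f(u_* )$ if $u^+\le u_*$ and $f_{out}(u^+)=f(u^+)$ if $u^+>u_*$. The Godunov flux is $H(u^-,u^+)=\min\{f_{in}(u^-),f_{out}(u^+)\}$ and the Godunov flux with three variables is $H(u^-,u^+,\alpha)=\min\{\alpha f_{in}(u^-),f_{out}(u^+)\}$. Junction fluxes at time $t$. $\alpha$-outside: $H_j=\sum_{i=1}^n\alpha_{j,i}H(u_{hi}^-(b_i,t),u_{hj}^+(a_j,t))$ for $j=n+1,\ldots,n+m$ and $H_i=\sum_{j=n+1}^{n+m}\alpha_{j,i}H(u_{hi}^-(b_i,t),u_{hj}^+(a_j,t))$ for $i=1,\ldots,n$. $\alpha$-inside: $H_j=\sum_{i=1}^n H(u_{hi}^-(b_i,t),u_{hj}^+(a_j,t),\alpha_{j,i})$ for $j=n+1,\ldots,n+m$ and $H_i=\sum_{j=n+1}^{n+m}H(u_{hi}^-(b_i,t),u_{hj}^+(a_j,t),\alpha_{j,i})$ for $i=1,\ldots,n$. DG formulation on a simple network: functions $u_{hk}\in C^1([0,T];S_{hk})$,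 $k=1,\ldots,n+m$, such that for all $t\in(0,T)$: (i) for all $i=1,\ldots,n$ and all $\varphi_i\in S_{hi}$, $$\int_{a_i}^{b_i}(u_{hi})_t\varphi_i\,\mathrm{d}x-\sum_{K\in\mathcal{T}_{hi}}\int_K f(u_{hi})\varphi_i'\,\mathrm{d}x+\sum_{x\in\mathcal{F}_{hi}^I}H(u_{hi}^-,u_{hi}^+)[\varphi_i]+H_i\varphi_i^-(b_i)-H\big(u_{Di},u_{hi}^+(a_i)\big)\varphi_i^+(a_i)=0,$$ where $u_{Di}=u_{Di}(t)$ is the given Dirichlet datum at the inflow boundary point $a_i$; (ii) for all $j=n+1,\ldots,n+m$ and all $\varphi_j\in S_{hj}$, $$\int_{a_j}^{b_j}(u_{hj})_t\varphi_j\,\mathrm{d}x-\sum_{K\in\mathcal{T}_{hj}}\int_K f(u_{hj})\varphi_j'\,\mathrm{d}x+\sum_{x\in\mathcal{F}_{hj}^I}H(u_{hj}^-,u_{hj}^+)[\varphi_j]+H\big(u_{hj}^-(b_j),u_{Dj}\big)\varphi_j^-(b_j)-H_j\varphi_j^+(a_j)=0.$$ *)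

(* Defs.v *)
From mathcomp Require Import all_boot all_order all_algebra.
From mathcomp Require Import all_classical all_reals all_analysis.
Set Implicit Arguments.
Unset Strict Implicit.
Unset Printing Implicit Defensive.
Import Order.TTheory GRing.Theory Num.Theory.
Import numFieldNormedType.Exports.
Local Open Scope classical_set_scope.
Local Open Scope ring_scope.

(* C^1 flux which is non-decreasing before its global maximum us and
   non-increasing after it. *)
Definition unimodal_flux (R : realType) (f : R -> R) (us : R) : Prop :=
  [/\ forall x, derivable f x 1,
      continuous (derive1 f),
      forall x, f x <= f us,
      {in `]-oo, us] &, {homo f : x y / x <= y}} &
      {in `[us, +oo[ &, {homo f : x y /~ x <= y}}].

Definition f_in (R : realType) (f : R -> R) (us u : R) : R :=
  if u < us then f u else f us.

Definition f_out (R : realType) (f : R -> R) (us u : R) : R :=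
  if u <= us then f us else f u.

Definition godunov (R : realType) (f : R -> R) (us ul ur : R) : R :=
  Num.min (f_in f us ul) (f_out f us ur).

Definition godunov3 (R : realType) (f : R -> R) (us ul ur alpha : R) : R :=
  Num.min (alpha * f_in f us ul) (f_out f us ur).

Definition trace_left (R : realType) (v : R -> R) (x : R) : R :=
  lim (v y @[y --> x^'-]).

Definition trace_right (R : realType) (v : R -> R) (x : R) : R :=
  lim (v y @[y --> x^'+]).

Definition jump (R : realType) (v : R -> R) (x : R) : R :=
  trace_left v x - trace_right v x.

(* A partition of [a, b] is given by s with itv_partition a b s, that is
   a < s_0 < ... < s_(size s - 1) = b; its e-th element, e < size s, is the
   closed interval [cell_lo a b s e, cell_hi b s e]. *)
Definition cell_lo (R : realType) (a b : R) (s : seq R) (e : nat) : R :=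
  nth b (a :: s) e.

Definition cell_hi (R : realType) (b : R) (s : seq R) (e : nat) : R :=
  nth b s e.

Definition cells_interior (R : realType) (a b : R) (s : seq R) : set R :=
  [set x | exists2 e, (e < size s)%N &
           x \in `]cell_lo a b s e, cell_hi b s e[].

(* Broken polynomials of degree at most p.  Since they may jump between
   elements, a single-valued function is constrained on the open elements
   only: its values at the endpoints are irrelevant, being replaced everywhere
   by the one-sided traces. *)
Definition dg_space (R : realType) (p : nat) (a b : R) (s : seq R)
    (v : R -> R) : Prop :=
  forall e, (e < size s)%N ->
  exists2 q : {poly R}, (size q <= p.+1)%N &
    {in `]cell_lo a b s e, cell_hi b s e[, forall x, v x = q.[x]}.

(* C^1([0, T]; S) for S = dg_space p a b s, the function u of (t, x) being seen
   as the curve t |-> u t.  S is finite-dimensional, so the choice of its norm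
   is immaterial; the supremum norm over the open elements is used, whose
   convergence is uniform convergence.  The curve w is the derivative of u on
   [0, T], one-sided at 0 and T. *)
Definition C1_dg_space (R : realType) (p : nat) (a b : R) (s : seq R) (T : R)
    (u : R -> R -> R) : Prop :=
  (forall t, t \in `[0, T] -> dg_space p a b s (u t)) /\
  exists w : R -> R -> R,
    forall t, t \in `[0, T] ->
    [/\ dg_space p a b s (w t),
        {uniform cells_interior a b s,
          ((fun x => (r - t)^-1 * (u r x - u t x))
             @[r --> within [set` `[0, T]] t^']) --> w t} &
        {uniform cells_interior a b s,
          (w r @[r --> within [set` `[0, T]] (nbhs t)]) --> w t}].

(* The DG equation at time t on one road, where flux_a and flux_b are the
   numerical fluxes used at the endpoints a and b. *)
Definition road_equation (R : realType) (f : R -> R) (us : R) (p : nat)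
    (a b : R) (s : seq R) (flux_a flux_b : R) (u : R -> R -> R) (t : R)
    : Prop :=
  forall phi : R -> R, dg_space p a b s phi ->
  \int[lebesgue_measure]_(x in [set` `[a, b]])
     (derive1 (fun r => u r x) t * phi x)
  - \sum_(0 <= e < size s)
      \int[lebesgue_measure]_(x in [set` `[cell_lo a b s e, cell_hi b s e]])
         (f (u t x) * derive1 phi x)
  + \sum_(x <- s | x \in `]a, b[)
      godunov f us (trace_left (u t) x) (trace_right (u t) x) * jump phi x
  + flux_b * trace_left phi b
  - flux_a * trace_right phi a = 0.

Variant junction_rule := AlphaOutside | AlphaInside.

(* In the junction fluxes, ul i is the trace at the junction of the i-th
   incoming road and ur j the one of the j-th outgoing road; alpha j i is the
   proportion of traffic going from i to j. *)
Definition flux_outgoing (R : realType) (f : R -> R) (us : R) (n m : nat)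
    (alpha : 'I_m -> 'I_n -> R) (rule : junction_rule)
    (ul : 'I_n -> R) (ur : 'I_m -> R) (j : 'I_m) : R :=
  match rule with
  | AlphaOutside => \sum_(i < n) alpha j i * godunov f us (ul i) (ur j)
  | AlphaInside => \sum_(i < n) godunov3 f us (ul i) (ur j) (alpha j i)
  end.

Definition flux_incoming (R : realType) (f : R -> R) (us : R) (n m : nat)
    (alpha : 'I_m -> 'I_n -> R) (rule : junction_rule)
    (ul : 'I_n -> R) (ur : 'I_m -> R) (i : 'I_n) : R :=
  match rule with
  | AlphaOutside => \sum_(j < m) alpha j i * godunov f us (ul i) (ur j)
  | AlphaInside => \sum_(j < m) godunov3 f us (ul i) (ur j) (alpha j i)
  end.

(* Roads are indexed by 'I_(n + m): lshift m i is the i-th incoming road and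
   rshift n j the j-th outgoing one.  uD k is the Dirichlet datum at the end of
   road k which is not at the junction. *)
Definition dg_solution (R : realType) (f : R -> R) (us : R) (n m : nat)
    (alpha : 'I_m -> 'I_n -> R) (p : nat) (a b : 'I_(n + m) -> R)
    (s : 'I_(n + m) -> seq R) (T : R) (uD : 'I_(n + m) -> R -> R)
    (rule : junction_rule) (u : 'I_(n + m) -> R -> R -> R) : Prop :=
  (forall k, C1_dg_space p (a k) (b k) (s k) T (u k)) /\
  forall t, t \in `]0, T[ ->
  let ul (i : 'I_n) := trace_left (u (lshift m i) t) (b (lshift m i)) in
  let ur (j : 'I_m) := trace_right (u (rshift n j) t) (a (rshift n j)) in
  (forall i : 'I_n, let k := lshift m i in
     road_equation f us p (a k) (b k) (s k)
       (godunov f us (uD k t) (trace_right (u k t) (a k)))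
       (flux_incoming f us alpha rule ul ur i)
       (u k) t) /\
  (forall j : 'I_m, let k := rshift n j in
     road_equation f us p (a k) (b k) (s k)
       (flux_outgoing f us alpha rule ul ur j)
       (godunov f us (trace_left (u k t) (b k)) (uD k t))
       (u k) t).

(* Main.v *)
Require Import Defs.
From mathcomp Require Import all_boot all_order all_algebra.
From mathcomp Require Import all_classical all_reals all_analysis.
From mathcomp Require Import measurable_realfun.
Set Implicit Arguments.
Unset Strict Implicit.
Unset Printing Implicit Defensive.
Import Order.TTheory GRing.Theory Num.Theory.
Import numFieldNormedType.Exports.
Local Open Scope classical_set_scope.
Local Open Scope ring_scope.

(** Testing the scheme on road k with the constant function 1 leaves only the
    numerical fluxes at the two endpoints, so that the integral of the time
    derivative of u_k is the inflow minus the outflow.  Summing over the roads,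
    the junction terms cancel because both rules give the same double sum over
    the pairs (i, j) on the incoming and on the outgoing side; it remains to
    differentiate under the integral.  This is possible since the difference
    quotients in time converge uniformly on the open elements, whose complement
    in [a_k, b_k] is finite, hence null. *)

(** * Open cells of a partition and their null complement *)

Lemma cells_interior_cons (R : realType) (a b x : R) (s : seq R) :
  cells_interior a b (x :: s) = [set` `]a, x[] `|` cells_interior x b s.
Proof.
apply/seteqP; split=> [y [[|e] /= elt ye]|y [ye|[e elt ye]]].
- by left.
- by right; exists e.
- by exists 0%N.
- by exists e.+1.
Qed.

Lemma dg_space_behead (R : realType) (p : nat) (a b x : R) (s : seq R)
    (v : R -> R) :
  dg_space p a b (x :: s) v -> dg_space p x b s v.
Proof. by move=> hv e elt; apply: (hv e.+1). Qed.

Lemma itv_setD_cells_interior (R : realType) (a b : R) (s : seq R) :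
  itv_partition a b s ->
  `[a, b]%classic `\` cells_interior a b s `<=` [set` a :: s].
Proof.
elim: s a => [|x s IH] a hs y [/=].
  by rewrite (itv_partition_nil hs) in_itv/= -eq_le inE eq_sym.
rewrite in_itv/= cells_interior_cons inE => /andP[ay yb] yNcell.
have [->//|yNa] := eqVneq y a.
(* Once [y] differs from [a], lying outside the first open cell forces [x <= y], so [y] is handled
   by the partition of [[x, b]]. *)
apply: (IH x (itv_partition_cons hs)); split=> [/=|yx].
  rewrite in_itv/= yb andbT leNgt; apply/negP => yx.
  by apply: yNcell; left; rewrite /= in_itv/= yx andbT lt_neqAle eq_sym yNa.
by apply: yNcell; right.
Qed.

Lemma ae_cells_interior (R : realType) (a b : R) (s : seq R) :
  itv_partition a b s ->
  \forall x \ae lebesgue_measure,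
    `[a, b]%classic x -> cells_interior a b s x.
Proof.
move=> hs.
have s0 : countable [set` a :: s] by exact/finite_set_countable/finite_seq.
exists [set` a :: s]; split.
- exact: countable_measurable.
- exact: countable_lebesgue_measure0.
- move=> x /= /not_implyP xs; exact: itv_setD_cells_interior xs.
Qed.

(** * Integrals of broken polynomials *)

Lemma ae_le_cst_integrable (R : realType) (a b M : R) (v : R -> R) :
  measurable_fun `[a, b] v ->
  (\forall x \ae lebesgue_measure, `[a, b]%classic x -> `|v x| <= M) ->
  lebesgue_measure.-integrable `[a, b] (EFin \o v).
Proof.
move=> mv vM; apply/integrableP; split; first exact/measurable_EFinP.
(* The dominating constant is [|M|]: the comparison of integrals asks for a nonnegative bound, and
   no sign is assumed on [M]. *)
apply: (@le_lt_trans _ _ (\int[lebesgue_measure]_(x in `[a, b]) (`|M|%:E)))%E.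
  apply: ae_ge0_le_integral => //.
  - exact/measurableT_comp/measurable_EFinP.
  - apply: (@filterS _ _ (ae_filter_ringOfSetsType _) _ _ _ vM) => x vx abx.
    by rewrite /= lee_fin (le_trans (vx abx))// ler_norm.
rewrite integral_cst//= lebesgue_measure_itv/=.
by case: ifP => _; rewrite -?EFinD -?EFinM ?mule0 ltry.
Qed.

Lemma dg_space_measurable (R : realType) (p : nat) (a b : R) (s : seq R)
    (v : R -> R) :
  itv_partition a b s -> dg_space p a b s v -> measurable_fun `[a, b] v.
Proof.
elim: s a => [|x s IH] a hs hv.
  by rewrite (itv_partition_nil hs) set_itv1; exact: measurable_fun_set1.
have xb := itv_partition_le (itv_partition_cons hs).
have ax : a < x by case: hs => /= /andP[].
have -> : `[a, b]%classic = `[a, x]%classic `|` `[x, b]%classic.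
  apply/seteqP; split=> y /=; rewrite !in_itv/=.
    move=> /andP[-> yb]; have [yx|/ltW xy] := leP y x; first by left.
    by right; rewrite xy.
  move=> [/andP[ay yx]|/andP[xy yb]]; apply/andP; split=> //.
    exact: le_trans xb.
  by rewrite (le_trans (ltW ax)).
apply/measurable_funU => //; split; last first.
  exact: IH (itv_partition_cons hs) (dg_space_behead hv).
have [q _ vq] := hv 0%N isT.
(* The flags [false true] select the open interval from [a] to [x], where [v] is a polynomial; the
   two endpoint values do not affect measurability. *)
apply: (@measurable_fun_itv_cc _ a x false true).
apply: (@eq_measurable_fun _ _ _ _ _ (horner q)).
  by move=> y; rewrite inE => /vq.
apply: measurable_funTS; apply: continuous_measurable_fun.
exact: continuous_horner.
Qed.

(** Each polynomial piece is continuous, hence bounded on the compact closure of its cell, and there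
    are finitely many cells. *)
Lemma dg_space_bounded (R : realType) (p : nat) (a b : R) (s : seq R)
    (v : R -> R) :
  dg_space p a b s v ->
  exists M, forall x, cells_interior a b s x -> `|v x| <= M.
Proof.
elim: s a => [|x s IH] a hv; first by exists 0 => x [].
have [M vM] := IH _ (dg_space_behead hv).
have [q _ vq] := hv 0%N isT.
have [N [_ qN]] : bounded_set (horner q @` `[a, x]).
  apply/compact_bounded/continuous_compact; last exact: segment_compact.
  exact/continuous_subspaceT/continuous_horner.
(* [bounded_set] provides bounds only by numbers strictly above [N], hence [N + 1]. *)
exists (Num.max M (N + 1)) => y.
rewrite cells_interior_cons le_max => -[yax|/vM ->//]; apply/orP; right.
rewrite vq//; apply: qN; first by rewrite ltrDl.
exists y => //; exact: subset_itv_oo_cc yax.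
Qed.

Lemma dg_space_integrable (R : realType) (p : nat) (a b : R) (s : seq R)
    (v : R -> R) :
  itv_partition a b s -> dg_space p a b s v ->
  lebesgue_measure.-integrable `[a, b] (EFin \o v).
Proof.
move=> hs hv; have [M vM] := dg_space_bounded hv.
apply: (@ae_le_cst_integrable _ _ _ M); first exact: dg_space_measurable hv.
apply: (@filterS _ _ (ae_filter_ringOfSetsType _) _ _ _
  (ae_cells_interior hs)) => x cx /cx; exact: vM.
Qed.

Lemma le_normr_Rintegral_cells (R : realType) (a b : R) (s : seq R) (v : R -> R)
    (e : R) :
  itv_partition a b s -> 0 <= e ->
  lebesgue_measure.-integrable `[a, b] (EFin \o v) ->
  (forall x, cells_interior a b s x -> `|v x| <= e) ->
  `|\int[lebesgue_measure]_(x in `[a, b]) v x| <= e * (b - a).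
Proof.
move=> hs e0 iv ve; rewrite -lee_fin EFin_normr_Rintegral//.
have mv := measurable_int _ iv.
apply: (le_trans (le_abse_integral _ _ _)) => //.
apply: (@le_trans _ _ (\int[lebesgue_measure]_(x in `[a, b]) e%:E)%E).
  apply: ae_ge0_le_integral => //; first exact: measurableT_comp.
  apply: (@filterS _ _ (ae_filter_ringOfSetsType _) _ _ _
    (ae_cells_interior hs)) => x cx /cx; rewrite lee_fin; exact: ve.
rewrite integral_cst//= lebesgue_measure_itv/= lte_fin EFinM.
(* The empty partition allows [a = b], where the measure and [b - a] both vanish. *)
have := itv_partition_le hs; rewrite le_eqVlt => /predU1P[->|->]//.
by rewrite ltxx subrr.
Qed.

Lemma eq_Rintegral_cells (R : realType) (p : nat) (a b : R) (s : seq R)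
    (v w : R -> R) :
  itv_partition a b s -> dg_space p a b s w ->
  (forall x, cells_interior a b s x -> v x = w x) ->
  \int[lebesgue_measure]_(x in `[a, b]) v x =
  \int[lebesgue_measure]_(x in `[a, b]) w x.
Proof.
move=> hs hw vw.
(* Membership in [dg_space] only looks at the open cells, so [v] inherits it from [w] and is
   measurable. *)
have hv : dg_space p a b s v.
  move=> e elt; have [q qp wq] := hw e elt; exists q => // x xe.
  by rewrite vw ?wq//; exists e.
congr fine; apply: ae_eq_integral => //.
- apply/measurable_EFinP; exact: dg_space_measurable hv.
- apply/measurable_EFinP; exact: dg_space_measurable hw.
apply: (@filterS _ _ (ae_filter_ringOfSetsType _) _ _ _
  (ae_cells_interior hs)) => x cx /cx /vw ->//.
Qed.

(** * Differentiation in time under the integral *)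

(** Since [t] is interior to [[0, T]], the one-sided restriction disappears near [t]; the
    substitution [r = h + t] then gives the increments used by the derivative. *)
Lemma near_difference_quotient (R : realType) (A : set R) (T t : R)
    (u : R -> R -> R) (w : R -> R) (e : R) :
  t \in `]0, T[ -> 0 < e ->
  {uniform A, ((fun x => (r - t)^-1 * (u r x - u t x))
                @[r --> within [set` `[0, T]] t^']) --> w} ->
  \forall h \near 0^', h + t \in `[0, T] /\
    forall x, A x -> `|w x - h^-1 * (u (h + t) x - u t x)| < e.
Proof.
move=> tT e0 uw.
have near_r : \forall r \near t^', r \in `[0, T] ->
    forall x, A x -> `|w x - (r - t)^-1 * (u r x - u t x)| < e.
  (* The functions within [e] of [w] on [A] form a neighbourhood of [w] for uniform convergence. *)
  apply: (uw [set g | forall x, A x -> `|w x - g x| < e]).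
  apply/uniform_nbhs; exists [set z | ball z.1 e z.2]; split=> //.
  exact: entourage_ball (PosNum e0).
have near_T : \forall r \near t^', r \in `[0, T].
  apply: nbhs_dnbhs; apply: filterS (near_in_itvoo tT) => r.
  exact: subset_itv_oo_cc.
have : \forall r \near t^', r \in `[0, T] /\
    forall x, A x -> `|w x - (r - t)^-1 * (u r x - u t x)| < e.
  by apply: filterS2 near_T near_r => r rT /(_ rT).
move=> /nbhs_ballP[d /= d0 td]; apply/nbhs_ballP; exists d => //= h.
rewrite /ball/= sub0r normrN => hd h0.
have := td (h + t); rewrite addrK; apply.
  by rewrite /ball/= opprD addrCA subrr addr0 normrN.
by rewrite -subr_eq0 addrK.
Qed.

Lemma is_derive_Rintegral_dg (R : realType) (p : nat) (a b : R) (s : seq R) (T t : R)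
    (u : R -> R -> R) :
  itv_partition a b s -> C1_dg_space p a b s T u -> t \in `]0, T[ ->
  is_derive t 1 (fun r => \int[lebesgue_measure]_(x in `[a, b]) u r x)
    (\int[lebesgue_measure]_(x in `[a, b]) derive1 (fun r => u r x) t).
Proof.
move=> hs [hu [w hw]] tT; have tT' := subset_itv_oo_cc tT.
have [wt uw _] := hw t tT'.
have near_uw := near_difference_quotient tT _ uw.
have iw := dg_space_integrable hs wt.
(* On the open cells uniform convergence is pointwise, so the time derivative is [w t] there; at the
   nodes it may be a default value, which the integral ignores. *)
have -> : \int[lebesgue_measure]_(x in `[a, b]) derive1 (fun r => u r x) t =
          \int[lebesgue_measure]_(x in `[a, b]) w t x.
  apply: (eq_Rintegral_cells hs wt) => x cx.
  apply/cvg_lim => //; apply/cvgrPdist_lt => e e0.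
  by apply: filterS (near_uw e e0) => h [_ /(_ x cx)].
suff cvg_F : h^-1 *: (((fun r => \int[lebesgue_measure]_(x in `[a, b]) u r x)
      \o shift t) (h *: 1) - \int[lebesgue_measure]_(x in `[a, b]) u t x)
    @[h --> 0^'] -->  \int[lebesgue_measure]_(x in `[a, b]) w t x.
  apply: DeriveDef; last exact: cvg_lim.
  by apply/cvg_ex; exists (\int[lebesgue_measure]_(x in `[a, b]) w t x).
apply/cvgrPdist_le => e e0.
have ab1 : 0 < b - a + 1.
  by rewrite ltr_wpDl// subr_ge0 (itv_partition_le hs).
(* This uniform tolerance, multiplied by the length [b - a], stays below [e]; the added 1 avoids
   division by zero. *)
have e1 : 0 < e / (b - a + 1) by rewrite divr_gt0.
apply: filterS (near_uw _ e1) => h [hT quot_lt].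
have iu := dg_space_integrable hs (hu _ hT).
have iut := dg_space_integrable hs (hu _ tT').
have iB : lebesgue_measure.-integrable `[a, b]
    (EFin \o (fun x => u (h + t) x - u t x)).
  by have := integrableB _ iu iut; apply.
have iZ : lebesgue_measure.-integrable `[a, b]
    (EFin \o (fun x => h^-1 * (u (h + t) x - u t x))).
  by have := integrableZl _ h^-1 iB; apply.
(* By linearity the error becomes a single integral, of [w t] minus the difference quotient. *)
rewrite /= scaler1 -RintegralB// -[_ *: _]RintegralZl// -RintegralB//.
have le_e : e / (b - a + 1) * (b - a) <= e.
  by rewrite mulrAC ler_pdivrMr// ler_pM2l// lerDl.
apply: le_trans le_e; apply: (le_normr_Rintegral_cells hs (ltW e1)).
  by have := integrableB _ iw iZ; apply.
by move=> x /quot_lt /ltW.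
Qed.

(** * Balance on each road and at the junction *)

Lemma road_equation_cst1 (R : realType) (f : R -> R) (us : R) (p : nat)
    (a b : R) (s : seq R) (flux_a flux_b : R) (u : R -> R -> R) (t : R) :
  road_equation f us p a b s flux_a flux_b u t ->
  \int[lebesgue_measure]_(x in `[a, b]) derive1 (fun r => u r x) t =
  flux_a - flux_b.
Proof.
have tl x : trace_left (cst 1 : R -> R) x = 1.
  by apply: cvg_lim => //; exact: cvg_cst.
have tr x : trace_right (cst 1 : R -> R) x = 1.
  by apply: cvg_lim => //; exact: cvg_cst.
move=> /(_ (cst 1)); rewrite tl tr !mulr1.
under eq_Rintegral do rewrite mulr1.
rewrite big1_seq => [|e _]; last first.
  under eq_Rintegral do rewrite derive1_cst mulr0.
  by rewrite Rintegral_cst// mul0r.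
rewrite big1_seq => [|x _]; last by rewrite /jump tl tr subrr mulr0.
rewrite subr0 addr0 => mass.
apply/eqP; rewrite -subr_eq0 opprB addrA mass// => e _.
(* The constant polynomial has size 1, which is at most [p.+1] for every [p]. *)
by exists 1%:P; [rewrite size_polyC oner_eq0|move=> x _; rewrite hornerC].
Qed.

Lemma sum_flux_incoming_outgoing (R : realType) (f : R -> R) (us : R) (n m : nat)
    (alpha : 'I_m -> 'I_n -> R) (rule : junction_rule)
    (ul : 'I_n -> R) (ur : 'I_m -> R) :
  \sum_(i < n) flux_incoming f us alpha rule ul ur i =
  \sum_(j < m) flux_outgoing f us alpha rule ul ur j.
Proof. by case: rule; rewrite exchange_big. Qed.

Theorem corollary13 (R : realType) (n m : nat) (hn : (0 < n)%N) (hm : (0 < m)%N)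
    (a b : 'I_(n + m) -> R) (hab : forall k, a k < b k)
    (alpha : 'I_m -> 'I_n -> R)
    (halpha : forall j i, 0 <= alpha j i <= 1)
    (halpha1 : forall i, \sum_(j < m) alpha j i = 1)
    (p : nat) (s : 'I_(n + m) -> seq R)
    (hs : forall k, itv_partition (a k) (b k) (s k))
    (f : R -> R) (us : R) (hf : unimodal_flux f us)
    (T : R) (hT : 0 < T)
    (uD : 'I_(n + m) -> R -> R)
    (rule : junction_rule)
    (u : 'I_(n + m) -> R -> R -> R)
    (hu : dg_solution f us alpha p a b s T uD rule u)
    (houtflow : forall (j : 'I_m) (t : R), t \in `]0, T[ ->
       uD (rshift n j) t = trace_left (u (rshift n j) t) (b (rshift n j))) :
  forall t : R, t \in `]0, T[ ->
  is_derive t 1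
    (fun r : R => \sum_(k < n + m)
       \int[lebesgue_measure]_(x in [set` `[a k, b k]]) u k r x)
    (\sum_(i < n) godunov f us (uD (lshift m i) t)
                    (trace_right (u (lshift m i) t) (a (lshift m i)))
     - \sum_(j < m) godunov f us
                      (trace_left (u (rshift n j) t) (b (rshift n j)))
                      (uD (rshift n j) t)).
Proof.
move=> t tT; have [C1u /(_ t tT) [road_in road_out]] := hu.
set H_in := flux_incoming _ _ _ _ _ _ in road_in.
set H_out := flux_outgoing _ _ _ _ _ _ in road_out.
(* The pointwise sum is rewritten as a sum of functions, the form that [is_derive_sum] expects. *)
have -> : (fun r => \sum_(k < n + m)
      \int[lebesgue_measure]_(x in [set` `[a k, b k]]) u k r x) =
    \sum_(k < n + m) (fun r =>
      \int[lebesgue_measure]_(x in [set` `[a k, b k]]) u k r x).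
  by apply/funext => r; rewrite fct_sumE.
have -> : \sum_(i < n) godunov f us (uD (lshift m i) t)
                    (trace_right (u (lshift m i) t) (a (lshift m i)))
     - \sum_(j < m) godunov f us
                      (trace_left (u (rshift n j) t) (b (rshift n j)))
                      (uD (rshift n j) t) =
    \sum_(k < n + m)
      \int[lebesgue_measure]_(x in `[a k, b k]) derive1 (fun r => u k r x) t.
  rewrite big_split_ord/=.
  under [in RHS]eq_bigr do rewrite (road_equation_cst1 (road_in _)).
  under [X in _ = _ + X]eq_bigr do rewrite (road_equation_cst1 (road_out _)).
  (* Incoming roads contribute boundary inflow minus [H_in], outgoing roads [H_out] minus boundary
     outflow; the equal junction totals telescope away. *)
  rewrite !sumrB /H_in /H_out sum_flux_incoming_outgoing.
  by rewrite addrA subrK.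
apply: is_derive_sum => k; exact: is_derive_Rintegral_dg (hs k) (C1u k) tT.
Qed.
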